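(* For a complete bipartite graph $K_{s,t}$ with integers $t\geq s\geq 4$, we have $px_3(K_{s,t})=2$.
   Context: All graphs are simple, finite, undirected and connected. $K_{s,t}$ denotes the complete bipartite graph with partite sets of sizes $s$ and $t$. An edge-coloring of a graph $G$ is any map $c:E(G)\to\{1,\dots,m\}$, $m\in\mathbb{N}$ (adjacent edges may receive the same color). A tree $T$ that is a subgraph of an edge-colored graph $G$ is a proper tree if no two adjacent edges of $T$ are assigned the same color. For $S\subseteq V(G)$, an $S$-tree is a tree that is a subgraph of $G$ and contains all vertices of $S$. For a connected graph $G$ of order $n$ and an integer $k$ with $2\le k\le n$, a $k$-proper coloring of $G$ is an edge-coloring such that for every set $S$ of $k$ vertices of $G$ there exists a proper $S$-tree in $G$. The $k$-proper index $px_k(G)$ is the minimum number of colors required in a $k$-proper coloring of $G$. *)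

(* Defs.v *)
From mathcomp Require Import all_boot.

Set Implicit Arguments.
Unset Strict Implicit.
Unset Printing Implicit Defensive.

(* Finite simple graphs.  Connectedness is not a field: a disconnected graph of
   order at least k >= 2 has no k-proper coloring, hence no k-proper index. *)
Record sgraph := SGraph {
  vertex :> finType;
  adj : rel vertex;
  adj_sym : symmetric adj;
  adj_irr : irreflexive adj }.

Definition edges (G : sgraph) : {set {set G}} :=
  [set [set p.1; p.2] | p : G * G & adj p.1 p.2].

Section Colorings.
Variable G : sgraph.

(* A pair (W, F) of a vertex set and an edge set represents a subgraph of G. *)
Implicit Types (S W : {set G}) (F : {set {set G}}) (c : {set G} -> nat).

Definition subgraph W F : Prop :=
  F \subset edges G /\ {in F, forall A : {set G}, A \subset W}.

Definition sub_adj F : rel G := fun x y => [set x; y] \in F.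

Definition connected_sub W F : Prop :=
  W != set0 /\ {in W &, forall x y, connect (sub_adj F) x y}.

(* [ucycle] also holds of the empty sequence and of [:: x; y] for every edge
   xy, so genuine graph cycles are those with at least three vertices. *)
Definition acyclic_sub F : Prop :=
  forall p : seq G, ucycle (sub_adj F) p -> size p < 3.

Definition tree W F : Prop :=
  [/\ subgraph W F, connected_sub W F & acyclic_sub F].

Definition S_tree S W F : Prop := tree W F /\ S \subset W.

(* Only the values of c on the edges of G matter. *)
Definition edge_coloring (m : nat) c : Prop :=
  {in edges G, forall A, 1 <= c A <= m}.

Definition proper_on c F : Prop :=
  {in F &, forall A B, A != B -> A :&: B != set0 -> c A != c B}.

Definition proper_coloring (k m : nat) c : Prop :=
  edge_coloring m c /\
  forall S, #|S| = k -> exists W F, S_tree S W F /\ proper_on c F.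

End Colorings.

(* px_k(G) = m, for G connected of order n and 2 <= k <= n. *)
Definition proper_index (k : nat) (G : sgraph) (m : nat) : Prop :=
  (exists c, @proper_coloring G k m c) /\
  (forall m' c, @proper_coloring G k m' c -> m <= m').

Section CompleteBipartite.
Variables s t : nat.

Definition Kst_adj : rel ('I_s + 'I_t)%type :=
  fun x y => match x, y with
             | inl _, inr _ | inr _, inl _ => true
             | _, _ => false
             end.

Lemma Kst_adj_sym : symmetric Kst_adj.
Proof. by case=> x [] y. Qed.

Lemma Kst_adj_irr : irreflexive Kst_adj.
Proof. by case. Qed.

Definition complete_bipartite : sgraph := SGraph Kst_adj_sym Kst_adj_irr.

End CompleteBipartite.

(* Main.v *)
Require Import Defs.
From mathcomp Require Import all_boot zify.

(** The upper bound: map the vertices of [K_{s,t}] onto [Z/8], the parity of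
    the class giving the side, and color an edge according to whether its
    classes differ by [±1] or by [±3].  With two colors a proper tree is an
    alternating path, and any three vertices [u], [v], [w], whatever their
    classes, lie on an alternating path whose other vertices are
    representatives of the classes not met by [u], [v], [w]; there are [8^3]
    cases.  The lower bound: a tree on three vertices has two adjacent edges. *)

Set Implicit Arguments.
Unset Strict Implicit.
Unset Printing Implicit Defensive.

(** * Sets with two or three elements *)

Lemma set2_inj (T : finType) (x y a b : T) :
  [set x; y] = [set a; b] -> x = a /\ y = b \/ x = b /\ y = a.
Proof.
move=> E.
have: x \in [set a; b] by rewrite -E set21.
have: y \in [set a; b] by rewrite -E set22.
have: a \in [set x; y] by rewrite E set21.
have: b \in [set x; y] by rewrite E set22.
rewrite !inE => /orP[]/eqP-> /orP[]/eqP-> /orP[]/eqP ? /orP[]/eqP ?;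
  by subst; auto.
Qed.

Lemma card3_set (T : finType) (S : {set T}) : #|S| = 3 ->
  exists u v w, uniq [:: u; v; w] /\ S = [set u; v; w].
Proof.
rewrite cardE; case E: (enum S) => [|u [|v [|w []]]] // _; exists u, v, w.
by rewrite -E enum_uniq; split=> //; apply/setP=> x;
   rewrite -mem_enum E !inE orbA.
Qed.

(** * Adjacent edges in a tree force a second color *)

Section LowerBound.
Variable G : sgraph.

(** Take three vertices [x], [y], [z] of [W]. If the paths from [x] to [y] and to [z] are single
    edges, these meet at [x]; otherwise one of the paths begins with two adjacent edges. *)
Lemma connected_adjacent_edges (W : {set G}) (F : {set {set G}}) :
  connected_sub W F -> 2 < #|W| ->
  exists A B, [/\ A \in F, B \in F, A != B & A :&: B != set0].
Proof.
move=> [_ conn] Wgt2.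
have [x [y [z [u3 [Wx Wy Wz]]]]] :
    exists x y z, uniq [:: x; y; z] /\ [/\ x \in W, y \in W & z \in W].
  have := enum_uniq W; have := mem_enum W; rewrite cardE in Wgt2.
  case: (enum W) Wgt2 => [|x [|y [|z r]]] // _ memW.
  rewrite -[_ :: _]/([:: x; y; z] ++ r) cat_uniq => /andP[u3 _].
  by exists x, y, z; rewrite -!memW !inE !eqxx !orbT.
have step v : v \in W -> x != v -> [set x; v] \in F \/
    exists A B, [/\ A \in F, B \in F, A != B & A :&: B != set0].
  move=> Wv xv; case/connectP: (conn _ _ Wx Wv) => p0 p0P p0l.
  case/shortenP: p0P p0l => p pP pu _ lp.
  case: p pP pu lp => [|a [|b p]] /=.
  - by move=> _ _ E; rewrite E eqxx in xv.
  - by rewrite andbT => Fxa _ ->; left.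
  (* The shortened path does not revisit [x], so [x] is not in [[set a; b]] and the two edges
     differ. *)
  rewrite !inE !negb_or => /and3P[Fxa Fab _] /andP[/and3P[xa xb _] _] _; right.
  exists [set x; a], [set a; b]; split=> //.
    by apply/eqP=> /setP/(_ x); rewrite !inE eqxx (negPf xa) (negPf xb).
  by apply/set0Pn; exists a; rewrite !inE eqxx orbT.
move: u3; rewrite /= !inE negb_or => /andP[/andP[xy xz] /andP[yz _]].
case: (step y Wy xy) => // Fxy; case: (step z Wz xz) => // Fxz.
exists [set x; y], [set x; z]; split=> //.
  apply/eqP=> /setP/(_ y).
  by rewrite !inE eqxx (negPf yz) orbT orbF eq_sym (negPf xy).
by apply/set0Pn; exists x; rewrite !inE eqxx.
Qed.

(** The bound [k <= #|G|] provides a set of [k] vertices, without which the tree condition would be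
    vacuous. *)
Lemma proper_coloring_gt1 k m (c : {set G} -> nat) :
  2 < k <= #|G| -> proper_coloring k m c -> 1 < m.
Proof.
case/andP=> kgt2 leG [cE cP].
have [S cardS] : exists S : {set G}, #|S| = k.
  exists [set x in take k (enum G)].
  rewrite cardsE (card_uniqP _) ?take_uniq ?enum_uniq //.
  by rewrite size_takel // -cardE.
have [W [F [[[[FE _] conn _] SW] Fc]]] := cP S cardS.
have Wgt2 : 2 < #|W| by rewrite (leq_trans kgt2) // -cardS subset_leq_card.
have [A [B [FA FB AB AIB]]] := connected_adjacent_edges conn Wgt2.
have := Fc _ _ FA FB AB AIB.
have := cE _ (subsetP FE _ FA); have := cE _ (subsetP FE _ FB).
by move=> /andP[? ?] /andP[? ?] /eqP ?; lia.
Qed.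

End LowerBound.

(** * Paths as proper trees *)

Section PathTree.
Variables (G : sgraph) (n : nat) (p : nat -> G).
Hypothesis p_inj : {in gtn n.+1 &, injective p}.
Hypothesis p_adj : forall i, i < n -> adj (p i) (p i.+1).

Definition path_vertices : {set G} := [set p i | i : 'I_n.+1].
Definition path_edges : {set {set G}} := [set [set p i; p i.+1] | i : 'I_n].

Lemma path_edgesP A :
  reflect (exists2 i, i < n & A = [set p i; p i.+1]) (A \in path_edges).
Proof.
apply: (iffP imsetP) => [[i _ ->]|[i lt_in ->]]; first by exists i.
by exists (Ordinal lt_in).
Qed.

Lemma path_vertex i : i <= n -> p i \in path_vertices.
Proof.
by move=> le_in; apply/imsetP; exists (Ordinal (le_in : i < n.+1)).
Qed.

Lemma path_sub_adjP x y : sub_adj path_edges x y ->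
  exists2 i, i < n & x = p i /\ y = p i.+1 \/ x = p i.+1 /\ y = p i.
Proof. by case/path_edgesP=> i lt_in /set2_inj; exists i. Qed.

Lemma sub_adj_sym (F : {set {set G}}) : symmetric (sub_adj F).
Proof. by move=> x y; rewrite /sub_adj setUC. Qed.

(* The neighbours of the vertex of largest index on a cycle would both be its
   unique predecessor on the path. *)
Lemma path_acyclic : acyclic_sub path_edges.
Proof.
move=> q /andP[qC qU]; rewrite ltnNge; apply/negP=> q3.
have q_index x : x \in q -> exists2 i, i <= n & x = p i.
  move=> xq; have /path_sub_adjP[i lt_in [[-> _]|[-> _]]] := next_cycle qC xq.
    by exists i => //; apply: ltnW.
  by exists i.+1.
pose P i := (i <= n) && (p i \in q).
have exP : exists i, P i.
  case: q q3 q_index {qC qU} @P => // x q _ /(_ x (mem_head _ _))[i le_in xE] P.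
  by exists i; rewrite /P le_in -xE mem_head.
have bP i : P i -> i <= n by case/andP.
case: (ex_maxnP exP bP) => m /andP[le_mn mq] m_max.
have pred y : y \in q -> sub_adj path_edges (p m) y -> 0 < m /\ y = p m.-1.
  move=> yq /path_sub_adjP[i lt_in [[mE yE]|[mE yE]]].
    have mi : m = i by apply: p_inj => //; rewrite inE ltnS // ltnW.
    by have := m_max i.+1; rewrite /P lt_in -yE yq mi ltnn => /(_ isT).
  have -> : m = i.+1 by apply: p_inj.
  by [].
have [k q' rotE] := rot_to mq.
have memE : p m :: q' =i q by move=> z; rewrite -rotE mem_rot.
move: qC qU q3; rewrite -(rot_cycle k) -(rot_uniq k) -(size_rot k) rotE.
case: q' rotE memE => [|y [|z r]] //= _ memE.
rewrite rcons_path => /and3P[my _ /andP[_ lm]] /and3P[_ yzr _] _.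
have [|_ yE] := pred y _ my; first by rewrite -memE !inE eqxx orbT.
have lzr : last z r \in z :: r by apply: mem_last.
have [|_ lE] := pred (last z r) _ (etrans (sub_adj_sym _ _ _) lm).
  by rewrite -memE 2!in_cons lzr !orbT.
by rewrite yE -lE lzr in yzr.
Qed.

Lemma path_tree : tree path_vertices path_edges.
Proof.
have pm i : i <= n -> connect (sub_adj path_edges) (p 0) (p i).
  elim: i => // i IHi lt_in; apply: connect_trans (IHi (ltnW lt_in)) _.
  by apply: connect1; apply/path_edgesP; exists i.
split; last exact: path_acyclic; split.
- apply/subsetP=> _ /path_edgesP[i lt_in ->].
  by apply/imsetP; exists (p i, p i.+1); rewrite ?inE ?p_adj.
- move=> _ /path_edgesP[i lt_in ->]; apply/subsetP=> x; rewrite !inE.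
  by case/orP=> /eqP->; apply: path_vertex => //; apply: ltnW.
- by apply/set0Pn; exists (p 0); apply: path_vertex.
move=> _ _ /imsetP[i _ ->] /imsetP[j _ ->].
apply: connect_trans (pm j (leq_ord j)).
by rewrite (sym_connect_sym (@sub_adj_sym _)) pm ?leq_ord.
Qed.

(** By injectivity of [p], two distinct edges of the path that share a vertex have consecutive
    indices. *)
Lemma path_proper (c : {set G} -> nat) :
  (forall i, i.+1 < n -> c [set p i; p i.+1] != c [set p i.+1; p i.+2]) ->
  proper_on c path_edges.
Proof.
move=> cP _ _ /path_edgesP[i lt_in ->] /path_edgesP[j lt_jn ->] AB.
case/set0Pn=> x; rewrite !inE => /andP[xi xj].
have ij : i != j by apply: contraNneq AB => ->.
have inj k l : k <= n -> l <= n -> p k = p l -> k = l.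
  by move=> *; apply: p_inj.
have [E|E] : j = i.+1 \/ i = j.+1.
  case/orP: xi => /eqP xi; case/orP: xj => /eqP; rewrite xi => /inj E;
    by have := E ltac:(lia) ltac:(lia); lia.
  by rewrite E cP // -E.
by rewrite E eq_sym cP // -E.
Qed.

End PathTree.

(** * The two-coloring by classes modulo 8 *)

Section ClassColoring.

(* On classes of opposite parity, [near] fails exactly when they differ by
   [±3] modulo 8. *)
Definition near (a b : nat) : bool := (a.+1 == b %[mod 8]) || (b.+1 == a %[mod 8]).

Lemma near_sym : symmetric near.
Proof. by move=> a b; rewrite /near orbC. Qed.

(* Labels [0 .. 7] stand for the representatives of the eight classes, and [8],
   [9], [10] for three given vertices of classes [a], [b], [c]. *)
Definition label_class (a b c l : nat) : nat := nth 0 (iota 0 8 ++ [:: a; b; c]) l.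

Section Labels.
Variables a b c : nat.
Let cl := label_class a b c.

(** The representative of a class met by a given vertex might be that very vertex, so it is
    excluded. *)
Definition usable_label (l : nat) : bool :=
  (l < 11) && ((l < 8) ==> (l \notin [:: a; b; c])).

(** The odd sum encodes adjacency; the color condition is vacuous at the last edge. *)
Definition alternating_at (q : seq nat) (i : nat) : bool :=
  let x := cl (nth 0 q i) in let y := cl (nth 0 q i.+1) in
  odd (x + y) &&
  ((i.+2 < size q) ==> (near x y != near y (cl (nth 0 q i.+2)))).

Definition valid_path (q : seq nat) : bool :=
  [&& uniq q, all usable_label q, all (mem q) [:: 8; 9; 10]
    & all (alternating_at q) (iota 0 (size q).-1)].

(** Depth-first search growing the path at its head, so only position 0 needs a new check. The
    result [[::]] means failure, and the fold keeps the first success. *)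
Fixpoint search (fuel : nat) (q : seq nat) : seq nat :=
  if all (mem q) [:: 8; 9; 10] then q else
  if fuel is f.+1 then
    foldl (fun r l =>
        if r is [::] then
          if [&& usable_label l, l \notin q & alternating_at (l :: q) 0]
          then search f (l :: q) else [::]
        else r) [::] (iota 0 11)
  else [::].

End Labels.

(** No correctness proof of [search] is needed: its output is checked case by case, and [valid_path]
    rejects [[::]]. Fuel 10 suffices, since a path uses at most 11 labels and starts with one. *)
Lemma search_valid a b c : a < 8 -> b < 8 -> c < 8 ->
  valid_path a b c (search a b c 10 [:: 8]).
Proof.
have: all (fun a => all (fun b => all (fun c =>
    valid_path a b c (search a b c 10 [:: 8])) (iota 0 8)) (iota 0 8)) (iota 0 8).
  by vm_compute.
move=> /allP H la lb lc; have := H a; rewrite mem_iota la => /(_ isT)/allP/(_ b).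
by rewrite mem_iota lb => /(_ isT)/allP/(_ c); rewrite mem_iota lc => /(_ isT).
Qed.

Variables (G : sgraph) (cls : G -> nat) (rep : nat -> G).
Hypothesis cls_lt : forall x, cls x < 8.
Hypothesis repK : forall k, k < 8 -> cls (rep k) = k.
Hypothesis adj_cls : forall x y : G, adj x y = odd (cls x + cls y).

Definition class_color (A : {set G}) : nat :=
  if [exists x, exists y, (A == [set x; y]) && near (cls x) (cls y)]
  then 2 else 1.

(** An edge determines its ends up to a swap, and [near] is symmetric. *)
Lemma class_color2 x y :
  class_color [set x; y] = if near (cls x) (cls y) then 2 else 1.
Proof.
rewrite /class_color; congr (if _ then _ else _).
apply/existsP/idP => [[x' /existsP[y' /andP[/eqP E]]]|N].
  by case: (set2_inj E) => [][-> ->] //; rewrite near_sym.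
by exists x; apply/existsP; exists y; rewrite eqxx.
Qed.

Lemma class_coloring_proper : proper_coloring 3 2 class_color.
Proof.
split=> [A _|S /card3_set[u [v [w [uvw SE]]]]].
  by rewrite /class_color; case: ifP.
have := search_valid (cls_lt u) (cls_lt v) (cls_lt w).
set q := search _ _ _ _ _; case/and4P=> qU /allP qL /allP qS /allP qA.
(* [vx] decodes labels into vertices; the default [u] is not reached for labels below 11. *)
pose vx l := nth u (map rep (iota 0 8) ++ [:: u; v; w]) l.
have clsE l : l < 11 -> cls (vx l) = label_class (cls u) (cls v) (cls w) l.
  by do 11![case: l => [|l]; first by rewrite /vx /= ?repK].
have vx_uvw l : 8 <= l < 11 -> vx l \in [:: u; v; w].
  by do 11![case: l => [|l]; first by rewrite /vx /= ?inE ?eqxx ?orbT].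
have vx_core l l' : l < 8 -> 8 <= l' < 11 -> l \in q -> vx l <> vx l'.
  move=> l8 l'8 lq E; have /andP[l11] := qL _ lq; rewrite l8 => /negP[].
  have <- : cls (vx l) = l.
    by rewrite clsE // /label_class nth_cat size_iota l8 nth_iota.
  by have := vx_uvw _ l'8; rewrite -E; apply: (map_f cls).
(* Two representatives are separated by their classes, a representative and a given vertex by
   [vx_core], and two given vertices by [uvw]. *)
have vx_inj : {in q &, injective vx}.
  move=> l l' lq l'q E.
  have /andP[l11 _] := qL _ lq; have /andP[l'11 _] := qL _ l'q.
  case: (ltnP l 8) (ltnP l' 8) => l8 [] l'8.
  - have := congr1 cls E; rewrite !clsE // /label_class !nth_cat size_iota.
    by rewrite l8 l'8 !nth_iota.
  - by case: (@vx_core l l') => //; rewrite l'8.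
  - by case: (@vx_core l' l) => //; rewrite l8.
  have szE k : k < 11 -> 8 <= k -> vx k = nth u [:: u; v; w] (k - 8).
    by move=> k11 k8; rewrite /vx nth_cat size_map size_iota ltnNge k8.
  have := E; rewrite !szE // => /eqP; rewrite nth_uniq //= ?ltn_subLR //.
  by move=> /eqP; lia.
have q_gt0 : 0 < size q by have := qS 8 isT; case: (q).
pose n := (size q).-1; pose p i := vx (nth 0 q i).
have szq : size q = n.+1 by rewrite /n prednK.
have inq i : i <= n -> nth 0 q i \in q by move=> ?; rewrite mem_nth // szq.
have p_inj : {in gtn n.+1 &, injective p}.
  move=> i j; rewrite !inE !ltnS => li lj /vx_inj E.
  by apply/eqP; rewrite -(nth_uniq 0 _ _ qU) ?szq // E ?inq.
have pclsE i : i <= n ->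
    label_class (cls u) (cls v) (cls w) (nth 0 q i) = cls (p i).
  by move=> /inq/qL/andP[? _]; rewrite clsE.
have alt i : i < n -> adj (p i) (p i.+1) /\
    (i.+1 < n -> near (cls (p i)) (cls (p i.+1))
                   != near (cls (p i.+1)) (cls (p i.+2))).
  move=> lt_in; have := qA i; rewrite mem_iota => /(_ lt_in).
  rewrite /alternating_at (pclsE _ (ltnW lt_in)) (pclsE _ lt_in) -adj_cls szq ltnS.
  by case/andP=> -> /implyP H; split=> // lt; rewrite -(pclsE i.+2) ?H.
exists (path_vertices n p), (path_edges n p); split; first split.
- by apply: path_tree => // i /alt[].
- have sub l : l \in q -> vx l \in path_vertices n p.
    move=> lq; rewrite -(nth_index 0 lq); apply: path_vertex.
    by rewrite -ltnS -szq index_mem.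
  apply/subsetP=> x; rewrite SE !inE -orbA.
  by case/or3P=> /eqP->; [apply: (sub 8) | apply: (sub 9) | apply: (sub 10)];
     apply: qS.
apply: path_proper => // i lt_in; have [_ /(_ lt_in)] := alt i (ltnW lt_in).
by rewrite !class_color2; do 2!case: ifP.
Qed.

End ClassColoring.

Theorem theorem5 (s t : nat) (hs : 4 <= s) (hst : s <= t) :
  proper_index 3 (complete_bipartite s t) 2.
Proof.
case: s hs hst => [//|s] hs; case: t => [//|t] hst; set G := complete_bipartite _ _.
(* Even classes on the left, odd ones on the right; all indices from 3 on share a class. Both sides
   have at least four vertices, so all eight classes occur. *)
pose cls (x : G) : nat := match x with
  | inl i => (minn i 3).*2
  | inr j => (minn j 3).*2.+1
  end.
pose rep k : G := if odd k then inr (inord k./2) else inl (inord k./2).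
split; last first.
  move=> m c; apply: proper_coloring_gt1.
  by rewrite /= card_sum !card_ord; lia.
exists (class_color cls); apply: (@class_coloring_proper _ _ rep).
- by case=> i /=; lia.
- by move=> k k8; rewrite /rep; case: ifP => k_odd /=; rewrite inordK; lia.
by case=> i [] j; rewrite /= ?addSn ?addnS /= oddD !odd_double.
Qed.
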